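(* Let $A_1,A_2\in\mathbb{R}^{n\times n}$ be symmetric matrices, $a,b\in\mathbb{R}^n$, $a_0,b_0\in\mathbb{R}$, and let $f_1(x)=x^TA_1x+2a^Tx+a_0$ and $f_2(x)=x^TA_2x+2b^Tx+b_0$ for $x\in\mathbb{R}^n$. Assume that $f_1$ and $f_2$ both satisfy the two-side Slater condition and that $v(\mathrm{Po4})=\inf_{x\in\mathbb{R}^n}\left[(f_1(x))^2+(f_2(x))^2\right]=0$. Let $\mathcal{P}=\{x\in\mathbb{R}^n: f_1(x)=f_2(x)=0\}$. Then $\mathcal{P}=\emptyset$ if and only if at least one of the following two cases happens: (a) $\{f_i=0\}$ separates $\{f_j=0\}$ for some $i\ne j$ in $\{1,2\}$; (b) there exist $i\neq j$ in $\{1,2\}$ such that at least one of the four problems $\inf\{\sigma f_i(x): x\in\mathbb{R}^n,\ \tau f_j(x)\le 0\}$, $\sigma,\tau\in\{+1,-1\}$, has optimal value equal to $0$; and moreover each of these four problems whose optimal value equals $0$ is unattainable.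
   Context: A function $f:\mathbb{R}^n\to\mathbb{R}$ satisfies the two-side Slater condition if there are $x,y\in\mathbb{R}^n$ with $f(x)<0<f(y)$. For a function $f$ on $\mathbb{R}^n$, $\{f=0\}$ denotes $\{x\in\mathbb{R}^n: f(x)=0\}$. Separation: for quadratic functions $f,g$ on $\mathbb{R}^n$ (i.e. functions of the form $x^TAx+2a^Tx+a_0$ with $A$ symmetric, possibly $A=0$), the level set $\{g=0\}$ is said to separate the set $\{f=0\}$ if there are non-empty subsets $L^-$ and $L^+$ of $\{f=0\}$ such that $L^-\cup L^+=\{f=0\}$ and $g(u^-)g(u^+)<0$ for all $u^-\in L^-$ and all $u^+\in L^+$. A minimization problem $\inf\{h(x): x\in S\}$ with optimal value $0$ is unattainable if there is no $x\in S$ with $h(x)=0$. *)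

(* Defs.v *)
From HB Require Import structures.
From mathcomp Require Import all_boot all_order all_algebra.
From mathcomp Require Import all_classical all_reals all_analysis.

Set Implicit Arguments.
Unset Strict Implicit.
Unset Printing Implicit Defensive.

Import Order.TTheory GRing.Theory Num.Theory.

Local Open Scope classical_set_scope.
Local Open Scope ring_scope.

Definition quad_fun (R : realType) (n : nat) (A : 'M[R]_n) (a : 'cV[R]_n)
    (a0 : R) (x : 'cV[R]_n) : R :=
  (x^T *m A *m x) 0 0 + 2 * (a^T *m x) 0 0 + a0.

Definition two_side_slater (R : realType) (n : nat) (f : 'cV[R]_n -> R) : Prop :=
  exists x y : 'cV[R]_n, f x < 0 /\ 0 < f y.

Definition zero_set (R : realType) (n : nat) (f : 'cV[R]_n -> R) :
    set 'cV[R]_n :=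
  [set x | f x = 0].

(* separates g f: the level set {g = 0} separates the set {f = 0}. *)
Definition separates (R : realType) (n : nat) (g f : 'cV[R]_n -> R) : Prop :=
  exists Lm Lp : set 'cV[R]_n,
    [/\ Lm !=set0, Lp !=set0, Lm `|` Lp = zero_set f &
        forall u v, Lm u -> Lp v -> g u * g v < 0].

(* The infimum is taken in \bar R, because the real-valued inf is 0 by
   convention on sets that are empty or not bounded below. *)
Definition opt_val (R : realType) (n : nat) (h : 'cV[R]_n -> R)
    (S : set 'cV[R]_n) : \bar R :=
  ereal_inf [set (h x)%:E | x in S].

(* Only meant for problems with optimal value 0. *)
Definition unattainable (R : realType) (n : nat) (h : 'cV[R]_n -> R)
    (S : set 'cV[R]_n) : Prop :=
  ~ exists x : 'cV[R]_n, S x /\ h x = 0.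

(* Main.v *)
(** If P is empty and neither level set separates the other, then f1 has
    constant sign on {f2 = 0} and f2 on {f1 = 0}; replacing f1, f2 by their
    opposites, both signs are positive.  By the intermediate value theorem for
    max(f1, f2) on segments, f1 <= 0 then forces f2 > 0.  If moreover f2 >= e > 0
    on {f1 <= 0}, the S-lemma would give f2 - e + lam * f1 >= 0 for some
    lam >= 0, which fails where f1 and f2 are both close to 0.  Only two points
    are needed for this contradiction, one with f1 and f2 small and one with
    f1 < 0, so it suffices to have the S-lemma on the line through them.  Hence
    inf {f2 : f1 <= 0} = 0.  Attainment is impossible, because a minimizer with
    f1 < 0 would be a local, hence a global, minimizer of f2. *)

Require Import Defs.
From HB Require Import structures.
From mathcomp Require Import all_boot all_order all_algebra.
From mathcomp Require Import all_classical all_reals all_analysis.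
From mathcomp Require Import ring lra.

Set Implicit Arguments.
Unset Strict Implicit.
Unset Printing Implicit Defensive.

Import Order.TTheory GRing.Theory Num.Theory.
Import numFieldNormedType.Exports.

Local Open Scope classical_set_scope.
Local Open Scope ring_scope.

(** All arguments below take place on the line through two points, put at s = 0 and s = 1; this
    property is also stable under the sign changes of f1 and f2. *)
Definition quadratic_on_lines (R : realType) (n : nat) (f : 'cV[R]_n -> R) :=
  forall x y : 'cV[R]_n, exists a b c : R,
    forall s, f (x + s *: (y - x)) = a * s ^+ 2 + b * s + c.

Section Lines.
Variables (R : realType) (n : nat).
Implicit Types (f g : 'cV[R]_n -> R) (x y : 'cV[R]_n).

Lemma quad_fun_on_lines (A : 'M[R]_n) (a : 'cV[R]_n) (a0 : R) :
  quadratic_on_lines (quad_fun A a a0).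
Proof.
move=> x y; move: (y - x) => d.
exists ((d^T *m A *m d) 0 0),
  ((x^T *m A *m d) 0 0 + (d^T *m A *m x) 0 0 + 2 * (a^T *m d) 0 0),
  (quad_fun A a a0 x) => s.
rewrite /quad_fun; have -> : (x + s *: d)^T = x^T + s *: d^T by rewrite linearD linearZ.
rewrite !(mulmxDl, mulmxDr).
rewrite -!(scalemxAl, scalemxAr) !mxE; ring.
Qed.

Lemma quadratic_on_linesZ (k : R) f :
  quadratic_on_lines f -> quadratic_on_lines (fun x => k * f x).
Proof.
move=> fq x y; have [a [b [c fE]]] := fq x y.
by exists (k * a), (k * b), (k * c) => s; rewrite fE; ring.
Qed.

Lemma line0 x y : x + 0 *: (y - x) = x.
Proof. by rewrite scale0r addr0. Qed.

Lemma line1 x y : x + 1 *: (y - x) = y.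
Proof. by rewrite scale1r addrC subrK. Qed.

End Lines.

(** * Quadratics in one real variable *)

Section OneVariable.
Variable R : realType.
Implicit Types (a b c s : R).

Lemma quadratic_continuous a b c :
  continuous (fun s : R => a * s ^+ 2 + b * s + c).
Proof.
have -> : (fun s : R => a * s ^+ 2 + b * s + c) =
          horner (a *: 'X^2 + b *: 'X + c%:P).
  by apply/funext => s; rewrite !hornerE.
exact: continuous_horner.
Qed.

Lemma quadratic_ivt a b c u v : u <= v ->
  (a * u ^+ 2 + b * u + c) * (a * v ^+ 2 + b * v + c) <= 0 ->
  exists2 s, u <= s <= v & a * s ^+ 2 + b * s + c = 0.
Proof.
move=> uv; set p := fun s => a * s ^+ 2 + b * s + c.
rewrite -/(p u) -/(p v) => puv.
have pc : {within `[u, v], continuous p}.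
  by apply: continuous_subspaceT; exact: quadratic_continuous.
have [|s sin ps] := @IVT R p u v 0 uv pc; last by exists s; rewrite // in_itv in sin.
rewrite ge_min le_max.
by case: (lerP (p u) 0) => pu; case: (lerP (p v) 0) => pv //=; nra.
Qed.

Lemma quadratic_pos_far a b c : 0 < a ->
  exists2 s, 1 <= s & 0 < a * s ^+ 2 + b * s + c.
Proof.
move=> a0; set k := (`|b| + `|c| + 1) / a.
have k0 : 0 <= k by apply: divr_ge0; [rewrite !addr_ge0|exact: ltW].
have ak : a * k = `|b| + `|c| + 1 by rewrite mulrC divfK ?gt_eqF.
exists (1 + k); first by lra.
have := ler_norm (- b); have := ler_norm (- c); rewrite !normrN => cl bl.
have -> : a * (1 + k) ^+ 2 + b * (1 + k) + c =
  (1 + k) * (a + a * k + b) + c by ring.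
rewrite ak; have := normr_ge0 c; nra.
Qed.

(* The S-lemma for two quadratics on a line.  The quadratic H := g2 + lam * g1
   is negative at 0 and 1, hence, depending on the sign of its polar form, on
   all of [0, 1] or on all of its complement; any zero of g1 there is
   suitable. *)
Lemma quadratic_s_lemma (a1 b1 c1 a2 b2 c2 lam : R) :
  0 < c1 -> a1 + b1 + c1 < 0 -> c2 + lam * c1 < 0 ->
  a2 + b2 + c2 + lam * (a1 + b1 + c1) < 0 ->
  exists s, a1 * s ^+ 2 + b1 * s + c1 <= 0 /\ a2 * s ^+ 2 + b2 * s + c2 < 0.
Proof.
move=> c10 g11 H0 H1.
(* [pol] is the polar form at 0 and 1: H(s) = H(0) (1 - s)^2 + H(1) s^2 + 2 pol s (1 - s). *)
pose pol := ((b2 + lam * b1) + 2 * (c2 + lam * c1)) / 2.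
have HE s : a2 * s ^+ 2 + b2 * s + c2 =
  (c2 + lam * c1) * (1 - s) ^+ 2
  + (a2 + b2 + c2 + lam * (a1 + b1 + c1)) * s ^+ 2
  + 2 * pol * (s * (1 - s)) - lam * (a1 * s ^+ 2 + b1 * s + c1).
  by rewrite /pol; field.
have zero s : a1 * s ^+ 2 + b1 * s + c1 = 0 -> pol * (s * (1 - s)) <= 0 ->
    exists s, a1 * s ^+ 2 + b1 * s + c1 <= 0 /\ a2 * s ^+ 2 + b2 * s + c2 < 0.
  move=> g1s ps; exists s; split; first by rewrite g1s.
  rewrite HE g1s; have [->|s0] := eqVneq s 0; first by nra.
  have : 0 < s ^+ 2 by rewrite exprn_even_gt0.
  have := sqr_ge0 (1 - s); nra.
have [pol0|pol0] := lerP pol 0.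
  have [||s /andP[s0 s1] /zero] := @quadratic_ivt a1 b1 c1 0 1; [lra|nra|].
  by apply; apply: mulr_le0_ge0 => //; apply: mulr_ge0; lra.
(* Now [pol] > 0, so a zero of g1 outside ]0, 1[ is wanted. Since g1(0) > 0 > g1(1), it lies left of
   0 if a1 < 0 and right of 1 if a1 > 0. *)
have [a10|a10|a10] := ltrgtP a1 0.
- have [//|s s1 ps] := @quadratic_pos_far (- a1) b1 (- c1); first by lra.
  have [||u /andP[u0 u1] /zero] := @quadratic_ivt a1 b1 c1 (- s) 0; [lra|nra|].
  by apply; apply: mulr_ge0_le0; [exact: ltW|apply: mulr_le0_ge0; lra].
- have [//|s s1 ps] := @quadratic_pos_far a1 b1 c1.
  have [||u /andP[u0 u1] /zero] := @quadratic_ivt a1 b1 c1 1 s; [lra|nra|].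
  by apply; apply: mulr_ge0_le0; [exact: ltW|apply: mulr_ge0_le0; lra].
(* Here g1 is affine with its only zero inside ]0, 1[, but it is negative from 1 on, and a2 = H(0) +
   H(1) - 2 pol < 0 makes g2 negative far away. *)
- have a20 : 0 < - a2 by rewrite a10 in H1; rewrite /pol in pol0; lra.
  have [s s1 ps] := quadratic_pos_far (- b2) (- c2) a20.
  by exists s; rewrite a10; split; nra.
Qed.

End OneVariable.

(** * Problems with optimal value zero *)

Section Infimum.
Variables (R : realType) (n : nat).
Implicit Types (f g h : 'cV[R]_n -> R) (S : set 'cV[R]_n).

Lemma opt_val0_ge0 h S x : opt_val h S = 0%E -> S x -> 0 <= h x.
Proof.
move=> h0 Sx; have : (opt_val h S <= (h x)%:E)%E.
  by apply: ereal_inf_lbound; exists x.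
by rewrite h0 lee_fin.
Qed.

Lemma opt_val0_lt h S e : opt_val h S = 0%E -> 0 < e ->
  exists2 x, S x & h x < e.
Proof.
rewrite /opt_val => h0 e0.
have [|_ [x Sx <-]] := @ereal_inf_lt R [set (h x)%:E | x in S] e%:E.
  by rewrite h0 lte_fin.
by rewrite lte_fin; exists x.
Qed.

Lemma opt_val0_intro h S : (forall x, S x -> 0 <= h x) ->
  (forall e, 0 < e -> exists2 x, S x & h x < e) -> opt_val h S = 0%E.
Proof.
move=> h0 hlt; apply/eqP; rewrite eq_le; apply/andP; split.
  apply/lee_addgt0Pr => e e0; rewrite add0e.
  have [x Sx hx] := hlt _ e0.
  apply: ge_ereal_inf; exists (h x)%:E; first by exists x.
  by rewrite lee_fin ltW.
by apply/ereal_infP => _ [x Sx <-]; rewrite lee_fin h0.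
Qed.

Lemma no_common_nonpos f g (v : 'cV[R]_n) :
  quadratic_on_lines f -> quadratic_on_lines g -> 0 < f v ->
  (forall x, f x = 0 -> 0 < g x) -> (forall x, g x = 0 -> 0 < f x) ->
  forall x, f x <= 0 -> 0 < g x.
Proof.
move=> fq gq fv fg gf x fx; rewrite ltNge; apply/negP => gx.
have [a [b [c fE]]] := fq x v.
have [a' [b' [c' gE]]] := gq x v.
set p := (fun s : R => a * s ^+ 2 + b * s + c) in fE.
set q := (fun s : R => a' * s ^+ 2 + b' * s + c') in gE.
have pqc : {within `[0, 1], continuous (p \max q : R -> R)}.
  apply: continuous_subspaceT => s.
  by apply: continuous_max; exact: quadratic_continuous.
have [|s _] := IVT ler01 pqc (v := 0).
  rewrite ge_min le_max /= ge_max !le_max.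
  rewrite -[p 0]fE -[q 0]gE -[p 1]fE line0 line1 fx gx (ltW fv) orbT //.
(* Where the maximum vanishes, one function is 0 and the other is at most 0, against [gf] or
   [fg]. *)
rewrite /= -[p s]fE -[q s]gE maxEle.
case: ifP => [le0 /[dup] g0 /gf|/negbT + f0]; first by rewrite -g0 ltNge le0.
by rewrite -ltNge f0 ltNge => /negP; apply; apply/ltW/fg.
Qed.

Lemma opt_val_eq0 f g (y v : 'cV[R]_n) :
  quadratic_on_lines f -> quadratic_on_lines g -> f y < 0 -> 0 < f v ->
  (forall x, f x = 0 -> 0 < g x) -> (forall x, g x = 0 -> 0 < f x) ->
  (forall e, 0 < e -> exists x, `|f x| < e /\ `|g x| < e) ->
  opt_val g [set x | f x <= 0] = 0%E.
Proof.
move=> fq gq fy fv fg gf small.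
have pos := no_common_nonpos fq gq fv fg gf.
apply: opt_val0_intro => [x /pos/ltW//|e e0].
apply: contrapT => nex.
have lb x : f x <= 0 -> e <= g x.
  by move=> fx; rewrite leNgt; apply/negP => gx; apply: nex; exists x.
have := lb y (ltW fy) => gy.
(* This multiplier makes g - e + [lam] * f equal to -1 at y; the bound on x below makes it negative
   at x too. *)
pose lam := (g y - e + 1) / - f y.
have lam0 : 0 <= lam by rewrite divr_ge0; lra.
have lamE : lam * f y = - (g y - e + 1).
  by rewrite /lam invrN mulrN mulNr divfK // lt_eqF.
have d0 : 0 < e / (1 + lam) by rewrite divr_gt0 //; lra.
have [x [fxd gxd]] := small _ d0.
have dE : e / (1 + lam) * (1 + lam) = e by rewrite divfK // gt_eqF //; lra.
have fx := le_lt_trans (ler_norm _) fxd.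
have gx := le_lt_trans (ler_norm _) gxd.
have gxe : g x < e by nra.
have fx0 : 0 < f x by rewrite ltNge; apply/negP => /lb; rewrite leNgt gxe.
have [a [b [c fE]]] := fq x y.
have [a' [b' [c' gE]]] := gq x y.
have f0 : c = f x by have := fE 0; rewrite line0 => ->; ring.
have f1 : a + b + c = f y by have := fE 1; rewrite line1 => ->; ring.
have g0 : c' = g x by have := gE 0; rewrite line0 => ->; ring.
have g1 : a' + b' + c' = g y by have := gE 1; rewrite line1 => ->; ring.
have [||||s []] := @quadratic_s_lemma R a b c a' b' (c' - e) lam.
- by rewrite f0.
- by rewrite f1.
- by rewrite f0 g0; nra.
- by rewrite f1 lamE addrA g1; lra.
rewrite -fE => /lb; rewrite gE; lra.
Qed.

(* A minimizer in the open set [g < 0] is a local minimizer of f, and a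
   quadratic function bounded below near a critical point is so everywhere. *)
Lemma opt_val_unattainable f g (y : 'cV[R]_n) :
  quadratic_on_lines f -> quadratic_on_lines g -> f y < 0 ->
  (forall x, ~ (f x = 0 /\ g x = 0)) ->
  opt_val f [set x | g x <= 0] = 0%E ->
  unattainable f [set x | g x <= 0].
Proof.
move=> fq gq fy nofg f0 [x [/= gx fx]].
have gx0 : g x < 0.
  by rewrite lt_neqAle gx andbT; apply/eqP => g0; apply: (nofg x).
have [a [b [c fE]]] := fq x y.
have [a' [b' [c' gE]]] := gq x y.
have fE0 : c = 0 by rewrite -fx; have := fE 0; rewrite line0 => ->; ring.
have fE1 : a + b + c = f y by have := fE 1; rewrite line1 => ->; ring.
have gE0 : c' = g x by have := gE 0; rewrite line0 => ->; ring.
(* The radius d = - g x / m is at most 1 and satisfies d (|a'| + |b'|) <= - g x, so both points x ±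
   d (y - x) are feasible. *)
pose m := `|a'| + `|b'| - g x.
have m0 : 0 < m.
  by rewrite /m; have := normr_ge0 a'; have := normr_ge0 b'; lra.
pose d := - g x / m.
have d0 : 0 < d by rewrite divr_gt0 //; lra.
have dm : d * m = - g x by rewrite divfK // gt_eqF.
have d1 : d <= 1.
  rewrite ler_pdivrMr // mul1r /m.
  by have := normr_ge0 a'; have := normr_ge0 b'; lra.
have near t : `|t| = d -> 0 <= a * t ^+ 2 + b * t.
  move=> td; have -> : a * t ^+ 2 + b * t = f (x + t *: (y - x)).
    by rewrite fE fE0 addr0.
  apply: (opt_val0_ge0 f0); rewrite /= gE gE0.
  have : a' * t ^+ 2 <= `|a'| * d.
    apply: le_trans (ler_norm _) _; rewrite normrM normrX td.
    by apply: ler_wpM2l => //; nra.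
  have : b' * t <= `|b'| * d.
    by apply: le_trans (ler_norm _) _; rewrite normrM td.
  have : d * (`|a'| + `|b'|) <= - g x by rewrite -dm /m; nra.
  lra.
have := near d (gtr0_norm d0).
have := near (- d); rewrite normrN (gtr0_norm d0) => /(_ erefl).
rewrite sqrrN mulrN => n1 n2.
(* Adding [n1] and [n2] gives a >= 0; since d <= 1, a + b >= a d + b >= 0, against f y < 0. *)
have ab : a + b < 0 by rewrite -fE1 fE0 addr0 in fy.
have a0 : 0 <= a by rewrite -(pmulr_lge0 _ (exprn_gt0 2 d0)); lra.
have : 0 <= a * d + b by rewrite -(pmulr_rge0 _ d0); lra.
nra.
Qed.

(** As g has no zero on {f = 0}, its negative and positive points there cover that set; if both
    kinds occurred, they would form a separating pair. *)
Lemma not_separates_sign f g :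
  (forall x, ~ (f x = 0 /\ g x = 0)) -> ~ separates g f ->
  exists2 s : R, s \in [:: 1; -1] & forall x, f x = 0 -> 0 < s * g x.
Proof.
move=> nofg nsep.
have [[u [fu gu]]|nneg] := pselect (exists u, f u = 0 /\ g u < 0); last first.
  exists 1; first by rewrite inE eqxx.
  move=> x fx; rewrite mul1r lt_neqAle leNgt; apply/andP; split.
    by apply/eqP => /esym gx; apply: (nofg x).
  by apply/negP => gx; apply: nneg; exists x.
exists (- 1); first by rewrite !inE eqxx orbT.
move=> x fx; rewrite mulN1r oppr_gt0 lt_neqAle leNgt; apply/andP; split.
  by apply/eqP => gx; apply: (nofg x).
apply/negP => gx; apply: nsep.
exists [set z | f z = 0 /\ g z < 0], [set z | f z = 0 /\ 0 < g z]; split.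
- by exists u.
- by exists x.
- apply/seteqP; split => z /=; first by case=> -[].
  move=> fz; case: (ltrgtP (g z) 0) => gz; [by left|by right|].
  by case: (nofg z).
- by move=> ? ? [_ ?] [_ ?]; nra.
Qed.

Lemma sign_mul_slater (s : R) f : s \in [:: 1; -1] -> two_side_slater f ->
  two_side_slater (fun x => s * f x).
Proof.
by rewrite !inE => /orP[] /eqP -> [x [y [fx fy]]];
  [exists x, y|exists y, x]; lra.
Qed.

Lemma sign_mul_eq0 (s c : R) : s \in [:: 1; -1] -> (s * c == 0) = (c == 0).
Proof.
by rewrite !inE => /orP[] /eqP ->; rewrite ?mul1r ?mulN1r ?oppr_eq0.
Qed.

Lemma sign_mul_norm (s c : R) : s \in [:: 1; -1] -> `|s * c| = `|c|.
Proof.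
by rewrite !inE => /orP[] /eqP ->; rewrite ?mul1r ?mulN1r ?normrN.
Qed.

End Infimum.

Theorem theorem9 (R : realType) (n : nat) (A1 A2 : 'M[R]_n) (a b : 'cV[R]_n)
    (a0 b0 : R) :
  A1^T = A1 -> A2^T = A2 ->
  let f1 := quad_fun A1 a a0 in
  let f2 := quad_fun A2 b b0 in
  let f := fun i : 'I_2 => tnth [tuple f1; f2] i in
  two_side_slater f1 -> two_side_slater f2 ->
  opt_val (fun x => f1 x ^+ 2 + f2 x ^+ 2) setT = 0%E ->
  [set x : 'cV[R]_n | f1 x = 0 /\ f2 x = 0] = set0 <->
  (exists i j : 'I_2, i != j /\ separates (f i) (f j)) \/
  (exists i j : 'I_2,
    [/\ i != j,
        exists s t : R,
          [/\ s \in [:: 1; -1], t \in [:: 1; -1] &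
              opt_val (fun x => s * f i x) [set x | t * f j x <= 0] = 0%E] &
        forall s t : R, s \in [:: 1; -1] -> t \in [:: 1; -1] ->
          opt_val (fun x => s * f i x) [set x | t * f j x <= 0] = 0%E ->
          unattainable (fun x => s * f i x) [set x | t * f j x <= 0]]).
Proof.
move=> _ _ f1 f2 f sl1 sl2 opt0.
have q1 : quadratic_on_lines f1 by exact: quad_fun_on_lines.
have q2 : quadratic_on_lines f2 by exact: quad_fun_on_lines.
have fq i : quadratic_on_lines (f i) by case: i => -[|[|//]] ilt.
have fsl i : two_side_slater (f i) by case: i => -[|[|//]] ilt.
have fij i j x : i != j -> f i x = 0 -> f j x = 0 -> f1 x = 0 /\ f2 x = 0.
  by case: i => -[|[|//]] ilt; case: j => -[|[|//]] jlt.
split=> [P0|].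
  have no12 x : ~ (f1 x = 0 /\ f2 x = 0).
    by move=> fx; have : [set x | f1 x = 0 /\ f2 x = 0] x by []; rewrite P0.
  have no21 x : ~ (f2 x = 0 /\ f1 x = 0) by case=> *; apply: (no12 x).
  have [|nsep] := pselect
    (exists i j : 'I_2, i != j /\ separates (f i) (f j)); first by left.
  (* Indices start at 0: the objective is ± f2 and the constraint is on ± f1. *)
  right; exists 1, 0; split=> //; last first.
    move=> s t ss ts.
    have [y [_ [fy _]]] := sign_mul_slater ss (fsl 1).
    apply: (opt_val_unattainable (y := y)) => //;
      [exact: quadratic_on_linesZ|exact: quadratic_on_linesZ|].
    move=> x /= [/eqP + /eqP]; rewrite !sign_mul_eq0 // => /eqP f2x /eqP f1x.
    by apply: (no12 x).
  have [s1|s1 s1s f1p] := not_separates_sign no21.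
    by apply: nsep; exists 0, 1.
  have [s2|s2 s2s f2p] := not_separates_sign no12.
    by apply: nsep; exists 1, 0.
  exists s2, s1; split => //.
  have [y [v [fy fv]]] := sign_mul_slater s1s sl1.
  apply: (opt_val_eq0 _ _ fy fv) => //;
    [exact: quadratic_on_linesZ|exact: quadratic_on_linesZ| | |].
  - by move=> x /= /eqP; rewrite sign_mul_eq0 // => /eqP /f2p.
  - by move=> x /= /eqP; rewrite sign_mul_eq0 // => /eqP /f1p.
  - move=> e e0; have [x _ /= fxe] := opt_val0_lt opt0 (exprn_gt0 2 e0).
    exists x; rewrite !sign_mul_norm //.
    have lt_e (r q : R) : r ^+ 2 + q ^+ 2 < e ^+ 2 -> `|r| < e.
      move=> rq; rewrite -(ltr_pXn2r (n := 2)) ?nnegrE ?normr_ge0 ?ltW //.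
      by rewrite real_normK ?num_real //; have := sqr_ge0 q; lra.
    by split; [exact: lt_e fxe|rewrite addrC in fxe; exact: lt_e fxe].
(* Conversely, a common zero x lies in one of the two separating parts, where its product with any
   point of the other is 0; it also attains the value 0 in all four problems. *)
move=> sep_or_opt; apply/seteqP; split => // x /= fx0.
have f0 i : f i x = 0 by case: fx0 => ? ?; case: i => -[|[|//]] ilt.
case: sep_or_opt => [[i [j [_ [Lm [Lp [Lm0 Lp0 LE sep]]]]]]|].
  have : (Lm `|` Lp) x by rewrite LE /zero_set /=.
  case: Lm0 Lp0 => [u Lu] [v Lv] [Lx|Lx].
    by have := sep _ _ Lx Lv; rewrite f0 mul0r ltxx.
  by have := sep _ _ Lu Lx; rewrite f0 mulr0 ltxx.
move=> [i [j [_ [s [t [ss ts opt]]] unatt]]].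
by apply: (unatt s t ss ts opt); exists x; rewrite /= !f0 !mulr0.
Qed.
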